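(* Let $f=(f_1,\dots,f_n):\mathbb{R}^n\to\mathbb{R}^n$ and let $B_0\subseteq\mathbb{R}^n$ be a bounded box such that $f$ has only finitely many zeros in $2B_0$, all of them simple. If the algorithm Miranda (described in the context) halts on input $(f,B_0)$, then its output queue $P$ is correct, that is: $P$ consists of non-overlapping isolating boxes of $f$ (their interiors are pairwise disjoint, and each contains exactly one zero of $f$), and $$\mathrm{Zero}_f(B_0)\subseteq\bigcup_{B\in P}\mathrm{Zero}_f(B)\subseteq \mathrm{Zero}_f(2B_0).$$
   Context: Boxes are axis-parallel closed hypercubes in $\mathbb{R}^n$; $w(B)=w_B$ is the side width of $B$ and $kB$ ($k>0$) is the box with the same center as $B$ and width $k\,w(B)$. For a box $B=\prod_{i=1}^n[a_i^-,a_i^+]$, the $i$-th faces $B_i^{-}$, $B_i^{+}$ are the subsets of $B$ where $x_i=a_i^-$, resp. $x_i=a_i^+$; $2B_i^{\pm}$ denotes the faces of the box $2B$. For a function $h$ and a set $S$, $h(S)=\{h(x):x\in S\}$. Standing assumption: $f$ is twice continuously differentiable. $J=J_f$ is the Jacobian matrix of $f$; a zero $\alpha$ is simple if $J(\alpha)$ is nonsingular. $\mathrm{Zero}_f(S)$ is the multiset of zeros of $f$ in $S$, counted with multiplicity. Tests on a box $B$: - Exclusion test $C_0(B)$: succeeds iff there is $i\in\{1,\dots,n\}$ with $0\notin f_i(B)$. - Jacobian test $JC(B)$: succeeds iff $0\notin\det(J_f(3B))$, where $J_f(3B)$ is the interval matrix whose $(i,j)$ entry is the interval $\frac{\partial f_i}{\partial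 x_j}(3B)$ (exact range), and the determinant of this interval matrix is computed in interval arithmetic (sum over permutations of signed products of entries). - MK test $MK(B)$: take a point $m\in B$ with $J^{-1}(m)$ well-defined, put $g=(g_1,\dots,g_n)=J^{-1}(m)f$; the test succeeds iff for every $i=1,\dots,n$, $g_i>0$ on $2B_i^+$ and $g_i<0$ on $2B_i^-$. $subdivide(B)$ splits $B$ into its $2^n$ congruent subboxes of half the width. Algorithm Miranda$(f,B_0)$: 1. Initialize the output queue $P\leftarrow\emptyset$ and the priority queue $Q\leftarrow\{B_0\}$. 2. While $Q\neq\emptyset$ do: 3. (in loop 2) Remove a biggest box $B$ from $Q$. 4. (in loop 2) If $C_0(B)$ succeeds, continue (discard $B$ and go to the next iteration). 5. (in loop 2) If $JC(B)$ succeeds then: 6. (in 5) Initialize a new queue $Q'\leftarrow\{B\}$. 7. (in 5) While $Q'\ne\emptyset$ do: 8. (in loop 7) $B'\leftarrow Q'.pop()$. 9. (in loop 7) If $C_0(B')$ fails then: 10. (in 9) If $MK(B')$ succeeds then: 11. (in 10) add $2B'$ to $P$; 12. (in 10) discard from $Q$ the boxes contained in $3B$; 13. (in 10) break out of loop 7. 14. (in loop 7, after the block of 9) Push the boxes of $subdivide(B)$ into $Q$. 15. (in loop 2) Else (i.e. if $JC(B)$ fails): 16. push the boxes of $subdivide(B)$ into $Q$. *)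

(* Defs.v *)
From HB Require Import structures.
From mathcomp Require Import all_boot all_order all_algebra all_fingroup.
From mathcomp Require Import all_classical all_reals all_analysis.

Set Implicit Arguments.
Unset Strict Implicit.
Unset Printing Implicit Defensive.

Import Order.TTheory GRing.Theory Num.Theory.
Import numFieldNormedType.Exports.

Local Open Scope classical_set_scope.
Local Open Scope ring_scope.

Section Smoothness.
Variables (R : realType) (n : nat).

Fixpoint Ck (k : nat) (h : 'rV[R]_n -> R) : Prop :=
  if k is k'.+1 then
    (forall x, differentiable h x) /\
    (forall j : 'I_n, Ck k' (fun x => 'D_(delta_mx 0 j) h x))
  else continuous h.

Definition twice_continuously_differentiable (f : 'rV[R]_n -> 'rV[R]_n) :=
  forall i : 'I_n, Ck 2 (fun x => f x 0 i).

(* The library's 'J f x acts on row vectors on the right, so its (i, j) entry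
   is the derivative of f_j along x_i; the transpose has entry (i, j) equal to
   the derivative of f_i along x_j. *)
Definition Jac (f : 'rV[R]_n -> 'rV[R]_n) (x : 'rV[R]_n) : 'M[R]_n :=
  ('J f x)^T.

Definition simple_zero (f : 'rV[R]_n -> 'rV[R]_n) (x : 'rV[R]_n) :=
  f x = 0 /\ Jac f x \in unitmx.

End Smoothness.

Section Boxes.
Variables (R : realType) (n : nat).

(* A hypercube is encoded by its center and its side width. *)
Definition box := ('rV[R]_n * R)%type.

Definition center (B : box) : 'rV[R]_n := B.1.
Definition width (B : box) : R := B.2.
Definition lower (B : box) (i : 'I_n) : R := center B 0 i - width B / 2.
Definition upper (B : box) (i : 'I_n) : R := center B 0 i + width B / 2.

Definition points (B : box) : set 'rV[R]_n :=
  [set x | forall i, lower B i <= x 0 i <= upper B i].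

Definition lower_face (B : box) (i : 'I_n) : set 'rV[R]_n :=
  [set x | points B x /\ x 0 i = lower B i].
Definition upper_face (B : box) (i : 'I_n) : set 'rV[R]_n :=
  [set x | points B x /\ x 0 i = upper B i].

Definition scale_box (k : R) (B : box) : box := (center B, k * width B).

Definition subdivide (B : box) : seq box :=
  [seq (center B + \row_i ((-1) ^+ (i \in s) * (width B / 4)), width B / 2)
    | s : {set 'I_n}].

End Boxes.

Section IntervalArithmetic.
Variable R : realType.

(* On compact intervals these pointwise operations are exactly the operations
   of interval arithmetic. *)
Definition iadd (X Y : set R) : set R := [set x + y | x in X & y in Y].
Definition imul (X Y : set R) : set R := [set x * y | x in X & y in Y].
Definition iscale (c : R) (X : set R) : set R := [set c * x | x in X].

(* Every occurrence of an entry varies independently of the others. *)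
Definition idet n (M : 'M[set R]_n) : set R :=
  \big[iadd/[set 0]]_(s : 'S_n)
    iscale ((-1) ^+ s) (\big[imul/[set 1]]_(i < n) M i (s i)).

End IntervalArithmetic.

Section Tests.
Variables (R : realType) (n : nat) (f : 'rV[R]_n -> 'rV[R]_n).

Definition C0 (B : box R n) : Prop :=
  exists i : 'I_n, ~ ((fun x => f x 0 i) @` points B) 0.

Definition JC (B : box R n) : Prop :=
  ~ idet (\matrix_(i, j) ((fun x => Jac f x i j) @` points (scale_box 3 B))) 0.

Definition MK_point (B : box R n) (m : 'rV[R]_n) : Prop :=
  points B m /\ Jac f m \in unitmx.

Definition preconditioned (m x : 'rV[R]_n) : 'rV[R]_n :=
  (invmx (Jac f m) *m (f x)^T)^T.

(* Outcome of the MK test once the point m has been chosen. *)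
Definition MK (B : box R n) (m : 'rV[R]_n) : Prop :=
  forall i : 'I_n,
    (forall x, upper_face (scale_box 2 B) i x -> 0 < preconditioned m x 0 i) /\
    (forall x, lower_face (scale_box 2 B) i x -> preconditioned m x 0 i < 0).

End Tests.

Section Algorithm.
Variables (R : realType) (n : nat) (f : 'rV[R]_n -> 'rV[R]_n).

Definition discard_inside (D : box R n) (Q : seq (box R n)) : seq (box R n) :=
  [seq C <- Q | ~~ `[< points C `<=` points D >]].

Definition remove (Q : seq (box R n)) (B : box R n) (Q1 : seq (box R n)) :=
  perm_eq Q (B :: Q1).

Definition remove_biggest (Q : seq (box R n)) (B : box R n)
    (Q1 : seq (box R n)) :=
  remove Q B Q1 /\ (forall C, C \in Q -> width C <= width B).

(* The algorithm leaves open the choice of the point m in the MK test, of the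
   box taken from Q among the biggest ones and of the box taken from Q'; the
   evaluation relations below allow every choice. A terminating run is a
   derivation. *)

(* [inner_loop B P Q Q' P1 Q1]: the loop on Q' started with queues P, Q, Q'
   exits with queues P1, Q1. *)
Inductive inner_loop (B : box R n) :
    seq (box R n) -> seq (box R n) -> seq (box R n) ->
    seq (box R n) -> seq (box R n) -> Prop :=
| inner_empty P Q : inner_loop B P Q [::] P Q
| inner_found P Q Q' B' Q'' m :
    remove Q' B' Q'' -> ~ C0 f B' -> MK_point f B' m -> MK f B' m ->
    inner_loop B P Q Q' (rcons P (scale_box 2 B'))
      (discard_inside (scale_box 3 B) Q)
| inner_next P Q Q' B' Q'' P1 Q1 :
    remove Q' B' Q'' ->
    C0 f B' \/ (exists m, MK_point f B' m /\ ~ MK f B' m) ->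
    inner_loop B P (Q ++ subdivide B) Q'' P1 Q1 ->
    inner_loop B P Q Q' P1 Q1.

(* [outer_loop P Q P1]: the main loop started with queues P, Q halts with
   output queue P1. *)
Inductive outer_loop :
    seq (box R n) -> seq (box R n) -> seq (box R n) -> Prop :=
| outer_empty P : outer_loop P [::] P
| outer_excluded P Q B Q1 P1 :
    remove_biggest Q B Q1 -> C0 f B ->
    outer_loop P Q1 P1 -> outer_loop P Q P1
| outer_JC P Q B Q1 P2 Q2 P1 :
    remove_biggest Q B Q1 -> ~ C0 f B -> JC f B ->
    inner_loop B P Q1 [:: B] P2 Q2 ->
    outer_loop P2 Q2 P1 -> outer_loop P Q P1
| outer_subdivide P Q B Q1 P1 :
    remove_biggest Q B Q1 -> ~ C0 f B -> ~ JC f B ->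
    outer_loop P (Q1 ++ subdivide B) P1 -> outer_loop P Q P1.

Definition Miranda_halts (B0 : box R n) (P : seq (box R n)) : Prop :=
  outer_loop [::] [:: B0] P.

End Algorithm.

Section Zeros.
Variables (R : realType) (n : nat) (f : 'rV[R]_n -> 'rV[R]_n).

Definition isolating (B : box R n) : Prop :=
  exists! x, points B x /\ f x = 0.

Definition nonoverlapping (P : seq (box R n)) : Prop :=
  pairwise (fun B C : box R n =>
    `[< interior (points B) `&` interior (points C) = set0 >]) P.

(* Simple zeros have multiplicity one. The multiplicity of a degenerate zero of
   a C^2 map is convention-dependent, so only its positivity is required. *)
Definition is_multiplicity (mu : 'rV[R]_n -> nat) : Prop :=
  forall x, f x = 0 -> (0 < mu x)%N /\ (simple_zero f x -> mu x = 1%N).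

(* Multisets of points are represented by their multiplicity functions. *)
Definition Zero (mu : 'rV[R]_n -> nat) (S : set 'rV[R]_n) (x : 'rV[R]_n) : nat :=
  if `[< S x /\ f x = 0 >] then mu x else 0%N.

Definition msubset (M N : 'rV[R]_n -> nat) : Prop :=
  forall x, (M x <= N x)%N.

Definition mbigcup (P : seq (box R n)) (M : box R n -> 'rV[R]_n -> nat)
    (x : 'rV[R]_n) : nat :=
  (\max_(B <- P) M B x)%N.

End Zeros.

(* Main.v *)
Require Import Defs.
From mathcomp Require Import all_boot all_order all_algebra perm.
From mathcomp Require Import all_classical all_reals all_analysis.
From mathcomp Require Import ring lra.

Set Implicit Arguments.
Unset Strict Implicit.
Unset Printing Implicit Defensive.

Import Order.TTheory GRing.Theory Num.Theory.
Import numFieldNormedType.Exports.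

Local Open Scope classical_set_scope.
Local Open Scope ring_scope.

(** Every output box is 2B for a dyadic subbox B of B0 on which both JC and MK
succeeded, so correctness splits into an analytic and a geometric half.

Analysis (MK_isolating). If JC(B) succeeds, every real matrix whose entries lie
in the ranges of the entries of the Jacobian over 3B is nonsingular. The mean
value theorem, applied to each component separately, turns f x = f y into
A (y - x) = 0 for such an A, so f is injective on 3B: 2B contains at most one
zero, and a zero of 3B can only be the one of 2B. Existence follows by
continuation. Let g be the preconditioned map J(m)^-1 f and c the centre of
B. The homotopy t g(x) + (1 - t)(x - c) does not vanish on the boundary of 2B,
since on each face g and x - c have the same sign in the corresponding
coordinate. Its Jacobian is J(m)^-1 (t J(x) + (1 - t) J(m)), and the entries of
t J(x) + (1 - t) J(m) still lie in the ranges over 3B, these being intervals;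
hence it is nonsingular for all t. Now the zero c at t = 0 is carried to t = 1 in
finitely many small steps: after a small step the value at the previous zero is
smaller than every boundary value, so the minimum over 2B of the squared norm
is reached in the interior, and an interior critical point with nonsingular
Jacobian is a zero.

Geometry (dyadic_dichotomy). All boxes come from a dyadic grid, and 3B is a union
of grid cells of the width of B. As the biggest box is processed first, every
box C still in the queue is at most as wide as B, hence it lies in 3B, and is
discarded, or stays on the other side of a face of 3B. In the second case
doubling C moves it by at most half the width of B, so 2C does not enter 2B.

The record loop_inv combines both halves with the fact that no zero is ever lost;
it is preserved by each step, and for an empty queue it is the theorem. *)

(** * The interval determinant and derivatives along lines *)

Section Analysis.
Variables (R : realType) (n : nat).

(** The Leibniz formula is one of the choices of entries over which the interval
determinant ranges. *)
Lemma det_in_idet (M : 'M[set R]_n) (A : 'M[R]_n) :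
  (forall i j, M i j (A i j)) -> idet M (\det A).
Proof.
move=> MA; rewrite /idet /determinant.
elim/big_ind2 : _ => // [x X y Y Xx Yy|s _]; first by exists x => //; exists y.
exists (\prod_i A i (s i)) => //.
by elim/big_ind2 : _ => // X x Y y Xx Yy; exists x => //; exists y.
Qed.

(** The only consequence of the Jacobian test that the analysis needs. The entries
of A may come from different points of S, which is what makes the condition
applicable row by row (mean value theorem) and to convex combinations. *)
Definition regular_on (f : 'rV[R]_n -> 'rV[R]_n) (S : set 'rV[R]_n) :=
  forall A : 'M[R]_n,
    (forall i j, ((fun x => Jac f x i j) @` S) (A i j)) -> A \in unitmx.

Lemma JC_regular (f : 'rV[R]_n -> 'rV[R]_n) (B : box R n) :
  JC f B -> regular_on f (points (scale_box 3 B)).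
Proof.
move=> jc A hA; rewrite unitmxE unitfE; apply/eqP => A0; apply: jc.
by rewrite -[X in idet _ X]A0; apply: det_in_idet => i j; rewrite mxE.
Qed.

(** Both difference quotients are the same function; this reduces the calculus
below to one real variable. *)
Lemma is_derive_line (g : 'rV[R]_n -> R) (x v : 'rV[R]_n) (t dg : R) :
  is_derive (x + t *: v) v g dg ->
  is_derive t 1 (fun s => g (x + s *: v)) dg.
Proof.
have E : (fun h : R => h^-1 *: (((fun s => g (x + s *: v)) \o shift t) (h *: 1)
          - g (x + t *: v)))
   = (fun h => h^-1 *: ((g \o shift (x + t *: v)) (h *: v) - g (x + t *: v))).
  apply/funext => h /=; congr (_ *: (g _ - _)).
  by rewrite /shift/= [_%:A]mulr1 scalerDl addrCA.
by case=> dv val; split; [rewrite /derivable E|rewrite /derive E].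
Qed.

Lemma MVT_line (g : 'rV[R]_n -> R) (dg : 'rV[R]_n -> 'rV[R]_n -> R) x y :
  (forall z v, is_derive z v g (dg z v)) ->
  exists2 t, 0 <= t <= 1 &
    g y - g x = dg (x + t *: (y - x)) (y - x).
Proof.
move=> gd.
have dline (t : R) : is_derive t 1 (fun s => g (x + s *: (y - x)))
                 (dg (x + t *: (y - x)) (y - x)).
  exact: (is_derive_line (gd _ _)).
have [|t t01] := @MVT _ (fun s => g (x + s *: (y - x))) _ 0 1 ltr01
   (fun t _ => dline t).
  apply/continuous_subspaceT => t.
  exact/differentiable_continuous/derivable1_diffP/(@ex_derive _ _ _ _ _ _ _ (dline t)).
rewrite scale0r addr0 scale1r [x + (y - x)]addrC subrK subr0 mulr1 => ->.
by exists t => //; move: t01; rewrite in_itv /= => /andP[/ltW-> /ltW].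
Qed.

Section Smooth.
Variable f : 'rV[R]_n -> 'rV[R]_n.
Hypothesis fC2 : twice_continuously_differentiable f.

(** The hypothesis is about components, whereas the Jacobian is that of the whole
map; f is recovered as the sum of its components times the basis vectors. *)
Lemma C2_differentiable x : differentiable f x.
Proof.
have -> : f = \sum_(i < n) (fun y => f y 0 i *: delta_mx 0 i).
  apply/funext => y; rewrite fct_sumE; exact: row_sum_delta.
apply: differentiable_sum => i; apply: differentiableZl.
by have [/(_ x)] := fC2 i.
Qed.

Lemma is_derive_component i x v :
  is_derive x v (fun y => f y 0 i) (\sum_j Jac f x i j * v 0 j).
Proof.
have df := C2_differentiable x.
have dv : derivable f x v by exact: diff_derivable.
split; first exact: (derivable_mxP _ _ _).1.
have := derive_mx dv; rewrite deriveEjacobian // => /matrixP/(_ 0 i).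
rewrite !mxE => H; rewrite -[LHS]H; apply: eq_bigr => j _.
by rewrite mulrC [Jac _ _ _ _]mxE.
Qed.

Lemma Jac_continuous i j : continuous (fun x => Jac f x i j).
Proof.
have -> : (fun x => Jac f x i j) =
          (fun x => 'D_(delta_mx 0 j) (fun y => f y 0 i) x).
  apply/funext => x; rewrite (@derive_val _ _ _ _ _ _ _
    (is_derive_component i x (delta_mx 0 j))).
  rewrite (bigD1 j) //= big1 => [|k kj]; rewrite [delta_mx _ _ _ _]mxE ?eqxx.
    by rewrite mulr1 addr0.
  by rewrite (negbTE kj) andbF mulr0.
move=> x; have [_ /(_ j)[/(_ x) d _]] := fC2 i.
exact: differentiable_continuous.
Qed.
End Smooth.
End Analysis.

(** * Zeros by minimisation and continuation *)

Section Existence.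
Variables (R : realType) (n : nat).
Implicit Types (D : box R n) (x v : 'rV[R]_n).

Definition inside D : set 'rV[R]_n := [set x | forall i, lower D i < x 0 i < upper D i].

Lemma upperE D i : upper D i = lower D i + width D.
Proof. by rewrite /upper /lower; lra. Qed.

Lemma compact_itv_rV (a b : 'I_n -> R) :
  compact [set x : 'rV[R]_n | forall i, a i <= x 0 i <= b i].
Proof.
have -> : [set x : 'rV[R]_n | forall i, a i <= x 0 i <= b i] =
          [set x : 'rV[R]_n | forall i, `[a i, b i]%classic (x 0 i)].
  by apply/seteqP; split => x /= h i; have := h i; rewrite in_itv.
apply: (@rV_compact R n (fun i => `[a i, b i]%classic)) => i.
exact: segment_compact.
Qed.

Lemma compact_pos_lbound (K : set 'rV[R]_n) (g : 'rV[R]_n -> R) :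
  compact K -> continuous g -> (forall x, K x -> 0 < g x) ->
  exists2 d, 0 < d & forall x, K x -> d <= g x.
Proof.
move=> cK cg gK; have [->|/set0P K0] := eqVneq K set0; first by exists 1.
have [c /set_mem Kc gc] := EVT_min_rV K0 cK (continuous_subspaceT cg).
by exists (g c); [exact: gK|move=> x Kx; apply: gc; exact: mem_set].
Qed.

(** Combines the bounds obtained for the finitely many coordinates into one. *)
Lemma common_pos_lbound (I : finType) (Q : I -> R -> Prop) :
  (forall i d e, d <= e -> Q i e -> Q i d) ->
  (forall i, exists2 d, 0 < d & Q i d) -> exists2 d, 0 < d & forall i, Q i d.
Proof.
move=> anti /(_ _)/cid2-/all_sig2[d d0 Qd].
exists (\big[Num.min/1]_i d i); first exact: lt_bigmin.
by move=> i; apply: anti (Qd i); exact: bigmin_le.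
Qed.

(** Interior points are those from which one can move a little in every direction,
which is the form needed to test minimality along lines. *)
Lemma inside_line D x v : inside D x ->
  exists2 e : R, 0 < e & forall t : R, `|t| < e -> points D (x + t *: v).
Proof.
move=> Dx.
pose Q (i : 'I_n) (e : R) :=
  forall t : R, `|t| < e -> lower D i <= (x + t *: v) 0 i <= upper D i.
have [|i|e e0 He] := @common_pos_lbound 'I_n Q; last first.
- by exists e => // t te i; apply: He.
- have /andP[lx xu] := Dx i.
  pose s := Num.min (x 0 i - lower D i) (upper D i - x 0 i).
  have s0 : 0 < s by rewrite lt_min !subr_gt0 lx.
  exists (s / (`|v 0 i| + 1)); first by rewrite divr_gt0 // ltr_wpDl.
  move=> t; rewrite ltr_pdivlMr ?ltr_wpDl // => ts.
  have : `|t * v 0 i| <= s.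
    by rewrite normrM; apply: le_trans (ltW ts); rewrite ler_wpM2l // lerDl.
  rewrite !mxE ler_norml le_min => /andP[/[swap]/andP[h1 h2]].
  rewrite lerNl le_min => /andP[h3 h4].
  by apply/andP; split; lra.
- by move=> i d e de Qe t td; apply: Qe; exact: lt_le_trans de.
Qed.

Definition norm2 (w : 'rV[R]_n) : R := \sum_i w 0 i ^+ 2.

Lemma norm2_ge (w : 'rV[R]_n) i : w 0 i ^+ 2 <= norm2 w.
Proof.
rewrite /norm2 (bigD1 i) //= lerDl; apply: sumr_ge0 => j _; exact: sqr_ge0.
Qed.

(** At an interior minimum the derivative of the squared norm vanishes in every
direction v, that is h(x) J(x) v = 0; as J(x) is invertible, h(x) = 0. *)
Lemma interior_min_zero D (h : 'rV[R]_n -> 'rV[R]_n) (J : 'rV[R]_n -> 'M[R]_n) x :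
  (forall z v i, is_derive z v (fun y => h y 0 i) ((J z *m v^T) i 0)) ->
  inside D x -> J x \in unitmx ->
  (forall y, points D y -> norm2 (h x) <= norm2 (h y)) -> h x = 0.
Proof.
move=> hd Dx Jx xmin.
suff hJ : h x *m J x = 0 by rewrite -[h x](mulmxK Jx) hJ mul0mx.
suff crit v : (h x *m J x *m v^T) 0 0 = 0.
  apply/rowP => j; have := crit (delta_mx 0 j).
  by rewrite trmx_delta -colE !mxE.
have [e e0 eD] := inside_line v Dx.
pose phi (t : R) : R := \sum_i (h (x + t *: v) 0 i) ^+ 2.
have dphi (t : R) : is_derive t 1 phi
    (\sum_i (h (x + t *: v) 0 i *: (J (x + t *: v) *m v^T) i 0 +
             h (x + t *: v) 0 i *: (J (x + t *: v) *m v^T) i 0)).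
  have -> : phi = \sum_i ((fun s => h (x + s *: v) 0 i) * (fun s => h (x + s *: v) 0 i)).
    by apply/funext => s; rewrite fct_sumE; apply: eq_bigr => i _; rewrite expr2.
  apply: is_derive_sum => i.
  have := is_derive_line (hd (x + t *: v) v i) => dl.
  exact: is_deriveM.
have t0 : (0 : R) \in `]-e, e[%R by rewrite in_itv /= e0 oppr_lt0 e0.
have d0 : is_derive (0 : R) 1 phi 0.
  apply: (@derive1_at_min _ phi (-e) e 0 _ _ t0) => [|t _|t te].
  - lra.
  - exact: (@ex_derive _ _ _ _ _ _ _ (dphi t)).
  - rewrite /phi scale0r addr0; apply: xmin; apply: eD.
    by move: te; rewrite in_itv /= ltr_norml.
have := @derive_val _ _ _ _ _ _ _ (dphi 0).
rewrite (@derive_val _ _ _ _ _ _ _ d0) scale0r addr0 -mulmxA => /esym.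
under eq_bigr do rewrite -mulr2n.
rewrite sumrMnl => /eqP; rewrite mulrn_eq0 /= => /eqP H.
by rewrite mxE; exact: H.
Qed.

Lemma convex_ge (d a b t : R) : 0 <= t <= 1 -> d <= a -> d <= b ->
  d <= t * a + (1 - t) * b.
Proof.
move=> /andP[t0 t1] da db; have -> : d = t * d + (1 - t) * d by ring.
by rewrite lerD // ler_wpM2l // subr_ge0.
Qed.

Lemma continuous_norm2 (h : 'rV[R]_n -> 'rV[R]_n) :
  (forall i, continuous (fun x => h x 0 i)) -> continuous (fun x => norm2 (h x)).
Proof.
move=> ch x.
have -> : (fun x => norm2 (h x)) = \sum_i (fun x => h x 0 i ^+ 2).
  by apply/funext => y; rewrite fct_sumE.
elim/big_ind : _ => [|g1 g2 c1 c2|i _]; first exact: cst_continuous.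
- exact: continuousD.
- by apply: (@continuous_comp _ _ _ _ (fun y : R => y ^+ 2));
  [exact: ch|exact: exprn_continuous].
Qed.

(** Continuation from l to g. On the boundary of D the squared norm of H t is at
least d ^+ 2 for all t, while H t x - H s x = (t - s)(g x - l x) is uniformly
small for s close to t. So when t advances by a step 1 / (N + 1) the value at the
old zero lies below all boundary values, and the minimum of the squared norm
over D is an interior point, a new zero by interior_min_zero. *)
Lemma homotopy_zero D (g l : 'rV[R]_n -> 'rV[R]_n)
    (J : R -> 'rV[R]_n -> 'M[R]_n) :
  let H t x := t *: g x + (1 - t) *: l x in
  (forall i, continuous (fun x => g x 0 i)) ->
  (forall i, continuous (fun x => l x 0 i)) ->
  (forall t z v i, is_derive z v (fun y => H t y 0 i) ((J t z *m v^T) i 0)) ->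
  (forall t x, 0 <= t <= 1 -> points D x -> J t x \in unitmx) ->
  (forall i x, upper_face D i x -> 0 < g x 0 i /\ 0 < l x 0 i) ->
  (forall i x, lower_face D i x -> g x 0 i < 0 /\ l x 0 i < 0) ->
  (exists2 x, points D x & l x = 0) ->
  exists2 x, points D x & g x = 0.
Proof.
move=> H cg cl dH Junit Hup Hlo [x0 Dx0 lx0].
have Ccompact : compact (points D) by exact: compact_itv_rV.
(* s = 1 serves the upper faces and s = -1 the lower ones. *)
have facebound (s : R) (side : 'I_n -> R) (h : 'rV[R]_n -> 'rV[R]_n) :
    (forall i, continuous (fun x => h x 0 i)) ->
    (forall i x, points D x -> x 0 i = side i -> 0 < s * h x 0 i) ->
    exists2 d, 0 < d & forall i x, points D x -> x 0 i = side i -> d <= s * h x 0 i.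
  move=> ch hpos.
  have [||d d0 dP] := @common_pos_lbound 'I_n
    (fun i d => forall x, points D x -> x 0 i = side i -> d <= s * h x 0 i).
  - by move=> i d e de He x Dx xi; exact: le_trans de (He _ Dx xi).
  - move=> i; have [|||d d0 dP] := @compact_pos_lbound
      (points D `&` [set x | x 0 i = side i]) (fun x => s * h x 0 i).
    + apply: compact_closedI => //.
      apply: (@closed_comp _ _ (fun x : 'rV[R]_n => x 0 i) [set side i]) => [x _|].
        exact: coord_continuous.
      exact: closed_eq.
    + move=> x; apply: continuousM; [exact: cst_continuous|exact: ch].
    + by move=> x [Dx xi]; exact: hpos.
    by exists d => // x Dx xi; exact: dP.
  - by exists d.
have [|d1 d10 d1P] := facebound 1 (upper D) g cg.
  by move=> i x Dx xi; rewrite mul1r; have [] := Hup i x (conj Dx xi).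
have [|d2 d20 d2P] := facebound 1 (upper D) l cl.
  by move=> i x Dx xi; rewrite mul1r; have [] := Hup i x (conj Dx xi).
have [|d3 d30 d3P] := facebound (-1) (lower D) g cg.
  by move=> i x Dx xi; rewrite mulN1r oppr_gt0; have [] := Hlo i x (conj Dx xi).
have [|d4 d40 d4P] := facebound (-1) (lower D) l cl.
  by move=> i x Dx xi; rewrite mulN1r oppr_gt0; have [] := Hlo i x (conj Dx xi).
pose d := Num.min (Num.min d1 d2) (Num.min d3 d4).
have d0 : 0 < d by rewrite !lt_min d10 d20 d30 d40.
have [dd1 dd2 dd3 dd4] : [/\ d <= d1, d <= d2, d <= d3 & d <= d4].
  by rewrite /d; split; rewrite !ge_min lexx ?orbT.
have Hbd t x : 0 <= t <= 1 -> points D x -> ~ inside D x -> d ^+ 2 <= norm2 (H t x).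
  move=> t01 Dx /existsNP[i /negP]; have /andP[lx xu] := Dx i.
  rewrite negb_and -!leNgt => xi; apply: le_trans (norm2_ge _ i).
  rewrite !mxE; case/orP: xi => xi.
    have {}xi : x 0 i = lower D i by apply/le_anti; rewrite xi lx.
    have := convex_ge t01 (le_trans dd3 (d3P i x Dx xi)) (le_trans dd4 (d4P i x Dx xi)).
    by move=> h; rewrite -[leRHS]sqrrN; rewrite ler_sqr ?nnegrE; lra.
  have {}xi : x 0 i = upper D i by apply/le_anti; rewrite xi xu.
  have := convex_ge t01 (le_trans dd1 (d1P i x Dx xi)) (le_trans dd2 (d2P i x Dx xi)).
  by rewrite !mul1r => h; rewrite ler_sqr ?nnegrE; lra.
have cgl : continuous (fun x => norm2 (g x - l x)).
  apply: (@continuous_norm2 (fun x => g x - l x)) => i x.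
  under eq_fun do rewrite !mxE.
  by apply: continuousB; [exact: cg|exact: cl].
have [c _ cmax] := EVT_max_rV (ex_intro _ x0 Dx0) Ccompact (continuous_subspaceT cgl).
(* L bounds the squared speed of the homotopy on D. *)
set L := norm2 (g c - l c) in cmax.
have L0 : 0 <= L by apply: sumr_ge0 => i _; exact: sqr_ge0.
(* The squared displacement in a step is at most L / (N + 1) ^ 2, hence less
   than d ^+ 2. *)
have [N NL] : exists N : nat, L < d ^+ 2 * N.+1%:R.
  exists (Num.truncn (L / d ^+ 2)).
  rewrite mulrC -ltr_pdivrMr ?exprn_gt0 //; exact: truncnS_gt.
pose s (k : nat) : R := k%:R / N.+1%:R.
have step k : (k <= N.+1)%N -> exists2 x, points D x & H (s k) x = 0.
  elim: k => [_|k IH kN].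
    by exists x0 => //; rewrite /H /s mul0r scale0r subr0 lx0 scaler0 addr0.
  have [x Dx Hx] := IH (ltnW kN).
  have s01 : 0 <= s k.+1 <= 1.
    by rewrite /s divr_ge0 //= ler_pdivrMr // mul1r ler_nat.
  have ds : s k.+1 - s k = N.+1%:R^-1.
    by rewrite /s -mulrBl -natrB // subSnn mul1r.
  have small : norm2 (H (s k.+1) x) < d ^+ 2.
    have -> : H (s k.+1) x = (s k.+1 - s k) *: (g x - l x).
      rewrite -[LHS]subr0 -Hx /H; apply/rowP => i; rewrite !mxE; ring.
    have -> : norm2 ((s k.+1 - s k) *: (g x - l x)) =
        (s k.+1 - s k) ^+ 2 * norm2 (g x - l x).
      rewrite /norm2 mulr_sumr; apply: eq_bigr => i _.
      by rewrite mxE exprMn.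
    have := cmax x (mem_set Dx); rewrite -/L => xL.
    rewrite ds; apply: le_lt_trans (_ : N.+1%:R^-1 * L < _).
      apply: le_trans (_ : N.+1%:R^-1 ^+ 2 * L <= _).
        by rewrite ler_wpM2l // sqr_ge0.
      rewrite ler_wpM2r // expr2 ler_piMl ?invr_ge0 //.
      by rewrite invf_le1 // ler1n.
    by rewrite mulrC ltr_pdivrMr.
  have cH : continuous (fun x => norm2 (H (s k.+1) x)).
    apply: continuous_norm2 => i z.
    under eq_fun do rewrite !mxE.
    have e1 : {for z, continuous (fun x => s k.+1 * g x 0 i)}.
      by apply: continuousM; [exact: cst_continuous|exact: cg].
    have e2 : {for z, continuous (fun x => (1 - s k.+1) * l x 0 i)}.
      by apply: continuousM; [exact: cst_continuous|exact: cl].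
    exact: (continuousD e1 e2).
  have [y /set_mem Dy ymin] :=
    EVT_min_rV (ex_intro _ x Dx) Ccompact (continuous_subspaceT cH).
  exists y => //; apply: (interior_min_zero (dH _)).
  - apply: contrapT => ny; have := Hbd _ _ s01 Dy ny.
    rewrite leNgt => /negP; apply; apply: le_lt_trans small.
    exact/ymin/mem_set.
  - exact: Junit.
  - by move=> z Dz; exact/ymin/mem_set.
have [x Dx] := step _ (leqnn _).
rewrite /H /s divff ?pnatr_eq0 // scale1r subrr scale0r addr0 => gx.
by exists x.
Qed.
End Existence.

(** * Miranda zeros and isolating boxes *)

Section Miranda.
Variables (R : realType) (n : nat).

Lemma is_derive_coord (z v : 'rV[R]_n) i :
  is_derive z v (fun y : 'rV[R]_n => y 0 i) (v 0 i).
Proof.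
have dc := @differentiable_coord R 1 n z 0 i.
split; first exact: diff_derivable.
have := derive_mx (@derivable_id R _ z v) => /matrixP/(_ 0 i).
by rewrite derive_id mxE => ->.
Qed.

(** The Poincare-Miranda theorem for maps whose Jacobian remains nonsingular when
it is deformed linearly to the identity; the deformation is the Jacobian of the
homotopy from x - c to g, where c is the centre of D. *)
Lemma Miranda_zero (D : box R n) (g : 'rV[R]_n -> 'rV[R]_n) (Dg : 'rV[R]_n -> 'M[R]_n) :
  0 < width D ->
  (forall i, continuous (fun x => g x 0 i)) ->
  (forall z v i, is_derive z v (fun y => g y 0 i) ((Dg z *m v^T) i 0)) ->
  (forall t x, 0 <= t <= 1 -> points D x -> t *: Dg x + (1 - t) *: 1%:M \in unitmx) ->
  (forall i x, upper_face D i x -> 0 < g x 0 i) ->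
  (forall i x, lower_face D i x -> g x 0 i < 0) ->
  exists2 x, points D x & g x = 0.
Proof.
move=> D0 cg dg Dgunit gup glo; pose l (x : 'rV[R]_n) := x - Defs.center D.
have dl z v i : is_derive z v (fun y => l y 0 i) (v 0 i).
  have -> : (fun y => l y 0 i) = (fun y : 'rV[R]_n => y 0 i) - cst (Defs.center D 0 i).
    by apply/funext => y; rewrite /l !mxE.
  by rewrite -[v 0 i]subr0; apply: is_deriveB; exact: is_derive_coord.
pose J (t : R) x := t *: Dg x + (1 - t) *: (1%:M : 'M[R]_n).
apply: (@homotopy_zero R n D g l J) => //.
- move=> i x; apply: (@continuous_comp _ _ _ l (fun z : 'rV[R]_n => z 0 i)).
    by apply: continuousB; [exact: id|exact: cst_continuous].
  exact: coord_continuous.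
- move=> t z v i.
  have -> : (fun y => (t *: g y + (1 - t) *: l y) 0 i) =
     t *: (fun y => g y 0 i) + (1 - t) *: (fun y => l y 0 i).
    by apply/funext => y; rewrite [LHS]mxE [X in X + _ = _]mxE [X in _ + X = _]mxE.
  have -> : (J t z *m v^T) i 0 = t *: (Dg z *m v^T) i 0 + (1 - t) *: v 0 i.
    rewrite /J mulmxDl -!scalemxAl mul1mx.
    by rewrite [LHS]mxE [X in X + _]mxE [X in _ + X]mxE [v^T _ _]mxE.
  by apply: is_deriveD; apply: is_deriveZ.
- move=> i x Dx; split; first exact: gup.
  have [_ xi] := Dx; rewrite /l !mxE xi /upper; lra.
- move=> i x Dx; split; first exact: glo.
  have [_ xi] := Dx; rewrite /l !mxE xi /lower; lra.
- exists (Defs.center D); last by rewrite /l subrr.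
  by move=> i; rewrite /lower /upper; apply/andP; split; lra.
Qed.
End Miranda.

Section Isolation.
Variables (R : realType) (n : nat) (f : 'rV[R]_n -> 'rV[R]_n).
Hypothesis fC2 : twice_continuously_differentiable f.
Implicit Types (B : box R n) (x y : 'rV[R]_n).

Lemma points_segment B x y (t : R) :
  0 <= t <= 1 -> points B x -> points B y -> points B (x + t *: (y - x)).
Proof.
move=> /andP[t0 t1] Bx By i; rewrite !mxE.
have /andP[lx xu] := Bx i; have /andP[ly yu] := By i.
have -> : x 0 i + t * (y 0 i - x 0 i) = (1 - t) * x 0 i + t * y 0 i by ring.
apply/andP; split; nra.
Qed.

Lemma points_scale_mono B (a b : R) : 0 < width B -> a <= b ->
  points (scale_box a B) `<=` points (scale_box b B).
Proof.
move=> B0 ab x Bx i; have := Bx i.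
rewrite /lower /upper /scale_box /Defs.center /width /= => /andP[h1 h2].
have : a * B.2 <= b * B.2 by rewrite ler_wpM2r // ltW.
by move=> h; apply/andP; split; lra.
Qed.

Lemma scale_box1 B : scale_box 1 B = B.
Proof. by case: B => c w; rewrite /scale_box /Defs.center /width mul1r. Qed.

(** Row i of A is the gradient of f_i at its own intermediate point z i, so A is
in general not a Jacobian matrix, but regular_on covers it. *)
Lemma regular_injective B x y : regular_on f (points B) ->
  points B x -> points B y -> f x = f y -> x = y.
Proof.
move=> reg Bx By fxy.
have mvt i : exists z, points B z /\ \sum_j Jac f z i j * (y - x) 0 j = 0.
  have [t t01 E] := MVT_line x y (fun z v => is_derive_component fC2 i z v).
  exists (x + t *: (y - x)); split; first exact: points_segment.
  by rewrite -E fxy subrr.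
have /boolp.choice[z zP] := mvt.
pose A : 'M[R]_n := \matrix_(i, j) Jac f (z i) i j.
have Au : A \in unitmx.
  by apply: reg => i j; exists (z i); [have [] := zP i|rewrite [A _ _]mxE].
have A0 : A *m (y - x)^T = 0.
  apply/colP => i; rewrite [LHS]mxE [RHS]mxE -[RHS](zP i).2.
  by apply: eq_bigr => j _; rewrite [A _ _]mxE [(y - x)^T _ _]mxE.
apply/esym/eqP; rewrite -subr_eq0 -trmx_eq0; apply/eqP.
by rewrite -[LHS](mulKmx Au) A0 mulmx0.
Qed.

Lemma IVT_line (G : 'rV[R]_n -> R) x y (t : R) : continuous G -> 0 <= t <= 1 ->
  exists2 s, 0 <= s <= 1 & G (y + s *: (x - y)) = t * G x + (1 - t) * G y.
Proof.
move=> cG t01; pose phi (s : R) : R := G (y + s *: (x - y)).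
have phi0 : phi 0 = G y by rewrite /phi scale0r addr0.
have phi1 : phi 1 = G x by rewrite /phi scale1r [y + _]addrC subrK.
have [||s s01 <-] := @IVT R phi 0 1 (t * G x + (1 - t) * G y) ler01.
- apply: continuous_subspaceT => s.
  apply: (@continuous_comp _ _ _ (fun s : R => y + s *: (x - y)) G); last exact: cG.
  apply: (@continuousD _ _ _ (fun=> y) (fun s : R => s *: (x - y))).
    exact: cst_continuous.
  exact: scalel_continuous.
- rewrite phi0 phi1; have /andP[t0 t1] := t01.
  rewrite ge_min le_max; case: (leP (G x) (G y)) => ab; apply/andP; split; apply/orP.
  + by right; nra.
  + by left; nra.
  + by left; nra.
  + by right; nra.
- by exists s => //; move: s01; rewrite /= in_itv.
Qed.

(** By the intermediate value theorem each entry of the convex combination is a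
value of the same entry of the Jacobian, at a point depending on the entry. *)
Lemma regular_convex B x y (t : R) : 0 <= t <= 1 ->
  regular_on f (points B) -> points B x -> points B y ->
  t *: Jac f x + (1 - t) *: Jac f y \in unitmx.
Proof.
move=> t01 reg Bx By; apply: reg => i j.
have [s s01 sE] := IVT_line x y (@Jac_continuous _ _ _ fC2 i j) t01.
exists (y + s *: (x - y)); first exact: points_segment.
by rewrite [RHS]mxE [X in _ = X + _]mxE [X in _ = _ + X]mxE.
Qed.

(** Preconditioning by J(m)^-1 makes the deformation of the Jacobian to the
identity equal to J(m)^-1 (t J(x) + (1 - t) J(m)), which is regular. *)
Lemma MK_zero B m : 0 < width B -> regular_on f (points (scale_box 3 B)) ->
  MK_point f B m -> MK f B m ->
  exists2 x, points (scale_box 2 B) x & f x = 0.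
Proof.
move=> B0 reg [Bm Jm] mk.
have sub23 : points (scale_box 2 B) `<=` points (scale_box 3 B).
  by apply: points_scale_mono => //; lra.
have B3m : points (scale_box 3 B) m.
  by apply: (@points_scale_mono _ 1) => //; [lra|rewrite scale_box1].
pose C := invmx (Jac f m); pose g := preconditioned f m.
have gE x i : g x 0 i = \sum_j C i j * f x 0 j.
  rewrite /g /preconditioned !mxE.
  by apply: eq_bigr => j _; rewrite [in X in _ * X]mxE.
have gsum i : (fun x => g x 0 i) = \sum_j C i j *: (fun x => f x 0 j).
  by apply/funext => y; rewrite gE fct_sumE.
have [||||||x Bx gx] := @Miranda_zero R n (scale_box 2 B) g (fun x => C *m Jac f x).
- by rewrite /width /= mulr_gt0.
- move=> i x; rewrite gsum.
  elim/big_ind : _ => [|g1 g2 c1 c2|j _]; first exact: cst_continuous.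
    exact: continuousD.
  change {for x, continuous (fun y => C i j * f y 0 j)}.
  apply: continuousM; first exact: cst_continuous.
  apply: (@continuous_comp _ _ _ f (fun z : 'rV[R]_n => z 0 j)); last first.
    exact: coord_continuous.
  exact/differentiable_continuous/C2_differentiable.
- move=> z v i; rewrite gsum.
  have -> : (C *m Jac f z *m v^T) i 0 = \sum_j C i j *: (\sum_k Jac f z j k * v 0 k).
    rewrite -mulmxA mxE; apply: eq_bigr => j _; congr (_ * _).
    by rewrite mxE; apply: eq_bigr => k _; rewrite [v^T _ _]mxE.
  apply: is_derive_sum => j; apply: is_deriveZ; exact: is_derive_component.
- move=> t x t01 Bx.
  have factor (A : 'M[R]_n) :
      t *: (C *m A) + (1 - t) *: 1%:M = C *m (t *: A + (1 - t) *: Jac f m).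
    by rewrite mulmxDr -!scalemxAr mulVmx.
  rewrite factor unitmx_mul unitmx_inv Jm /=.
  by apply: (@regular_convex (scale_box 3 B)) => //; exact: sub23.
- by move=> i x; exact: (mk i).1.
- by move=> i x; exact: (mk i).2.
exists x => //; apply: trmx_inj; rewrite -[LHS](mulKVmx Jm).
have -> : invmx (Jac f m) *m (f x)^T = 0.
  by apply: trmx_inj; rewrite trmx0; exact: gx.
by rewrite mulmx0 trmx0.
Qed.

(** Uniqueness holds in 3B rather than only in 2B; this is why no zero is lost when
the boxes inside 3B are discarded. *)
Lemma MK_isolating B m : 0 < width B -> JC f B -> MK_point f B m -> MK f B m ->
  isolating f (scale_box 2 B) /\
  forall x, points (scale_box 3 B) x -> f x = 0 -> points (scale_box 2 B) x.
Proof.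
move=> B0 /JC_regular reg Bm mk.
have [x Bx fx] := MK_zero B0 reg Bm mk.
have sub23 : points (scale_box 2 B) `<=` points (scale_box 3 B).
  by apply: points_scale_mono => //; lra.
have uniq y : points (scale_box 3 B) y -> f y = 0 -> x = y.
  move=> By fy; apply: (regular_injective reg) => //; first exact: sub23.
  by rewrite fx fy.
split; last by move=> y By fy; rewrite -(uniq y).
by exists x; split=> [//|y [By fy]]; apply: uniq => //; exact: sub23.
Qed.
End Isolation.

(** * Geometry of the dyadic grid *)

Section Grid.
Variables (R : realType) (n : nat).
Implicit Types (B C D : box R n) (x : 'rV[R]_n).

Definition refines C B :=
  forall i, lower B i <= lower C i /\ upper C i <= upper B i.

Lemma refines_sub C B : refines C B -> points C `<=` points B.
Proof.
move=> CB x Cx i; have [lB uB] := CB i; have /andP[lx xu] := Cx i.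
by rewrite (le_trans lB lx) (le_trans xu uB).
Qed.

Lemma lower_scale k B i : lower (scale_box k B) i = lower B i - (k - 1) / 2 * width B.
Proof. by rewrite /lower /scale_box /Defs.center /width /=; field. Qed.

Lemma upper_scale k B i : upper (scale_box k B) i = upper B i + (k - 1) / 2 * width B.
Proof. by rewrite /upper /scale_box /Defs.center /width /=; field. Qed.

Definition separated C B :=
  exists i, upper C i <= lower B i \/ upper B i <= lower C i.

(** An interior point can be moved by e / 2 in both directions of the i-th axis
without leaving D. *)
Lemma interior_coord D i x : interior (points D) x -> lower D i < x 0 i < upper D i.
Proof.
move=> /nbhs_ballP[e /= e0 eD].
have inD (s : R) : `|s| < e -> points D (x + s *: delta_mx 0 i).
  move=> se; apply: eD; rewrite -ball_normE /ball_ /= opprD addNKr normrN normrZ.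
  apply: le_lt_trans se; rewrite ler_piMr // /Num.norm /= mx_normrE.
  apply: bigmax_le => // j _; rewrite mxE; case: andP => _; by rewrite ?normr0 ?normr1.
have e2 : 0 < e / 2 by rewrite divr_gt0.
have e2e : e / 2 < e by lra.
have h1 : points D (x + (e / 2) *: delta_mx 0 i) by apply: inD; rewrite gtr0_norm.
have h2 : points D (x + (- (e / 2)) *: delta_mx 0 i).
  by apply: inD; rewrite normrN gtr0_norm.
have := h1 i; have := h2 i; rewrite !mxE !eqxx !mulr1.
move=> /andP[a _] /andP[_ b].
by apply/andP; split; lra.
Qed.

Lemma separated_disjoint C D :
  separated C D -> interior (points C) `&` interior (points D) = set0.
Proof.
move=> [i CD]; rewrite -subset0 => x [Cx Dx].
have := interior_coord i Cx; have := interior_coord i Dx.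
move=> /andP[a b] /andP[c d]; case: CD => h.
  by have := lt_trans a (lt_le_trans d h); rewrite ltxx.
by have := lt_trans c (lt_le_trans b h); rewrite ltxx.
Qed.

(** Doubling C moves its faces by half the width of C, and 2B lies at distance half
the width of B inside 3B. *)
Lemma separated_double C B : 0 < width C -> width C <= width B ->
  separated C (scale_box 3 B) -> separated (scale_box 2 B) (scale_box 2 C).
Proof.
move=> C0 CB [i]; rewrite lower_scale upper_scale => h; exists i.
by rewrite !lower_scale !upper_scale; case: h => h; [right|left]; lra.
Qed.

Lemma separated_refines C' C D : refines C' C -> separated C D -> separated C' D.
Proof.
move=> CC [i h]; have [l u] := CC i; exists i.
by case: h => h; [left|right]; [exact: le_trans u h|exact: le_trans h l].
Qed.

(** B is the cell of index z of the grid of level k that subdivides B0. *)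
Definition dyadic (B0 B : box R n) := exists k (z : 'I_n -> nat),
  width B = width B0 / 2 ^+ k /\
  forall i, (z i < 2 ^ k)%N /\ lower B i = lower B0 i + (z i)%:R * width B.

Section Dyadic.
Variable B0 : box R n.
Hypothesis B0pos : 0 < width B0.

Lemma dyadic_refl : dyadic B0 B0.
Proof.
exists 0%N, (fun=> 0%N); split; first by rewrite expr0 divr1.
by move=> i; rewrite mul0r addr0.
Qed.

Lemma dyadic_width_gt0 B : dyadic B0 B -> 0 < width B.
Proof. by move=> [k [z [-> _]]]; rewrite divr_gt0 // exprn_gt0. Qed.

Lemma dyadic_double_sub B : dyadic B0 B ->
  points (scale_box 2 B) `<=` points (scale_box 2 B0).
Proof.
move=> dB; have B0' := dyadic_width_gt0 dB; case: dB => k [z [wB zB]].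
apply: refines_sub => i; have [zk lB] := zB i.
have p0 : 0 < (2 : R) ^+ k by rewrite exprn_gt0.
have wE : width B0 = 2 ^+ k * width B by rewrite wB mulrC divfK // gt_eqF.
have z0 : 0 <= (z i)%:R * width B by rewrite mulr_ge0 // ltW.
have p1 : 1 <= (2 : R) ^+ k by rewrite exprn_ege1 // ler1n.
have h1 : width B <= width B0 by rewrite wE ler_peMl // ltW.
have h2 : (z i)%:R * width B + width B <= width B0.
  rewrite wE -[X in _ + X]mul1r -mulrDl ler_wpM2r ?(ltW B0') //.
  by rewrite natr1 -natrX ler_nat.
rewrite !lower_scale !upper_scale !upperE lB; split; lra.
Qed.

(** In units of the width of C, all of the coordinates of the faces of C and of 3B
relative to B0 are integers; an integer interval of length one either lies in a
given integer interval or meets it at most in an endpoint. *)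
Lemma dyadic_dichotomy B C : dyadic B0 B -> dyadic B0 C ->
  width C <= width B -> ~ points C `<=` points (scale_box 3 B) ->
  separated C (scale_box 3 B).
Proof.
move=> dB dC CB nsub; apply: contrapT => nsep; apply: nsub.
have C0 := dyadic_width_gt0 dC.
case: dB => kB [zB [wB hB]]; case: dC => kC [zC [wC hC]].
have kBC : (kB <= kC)%N.
  move: CB; rewrite wB wC ler_pM2l // lef_pV2 ?posrE ?exprn_gt0 //.
  by rewrite ler_eXn2l // ltr1n.
(* d cells of the size of C fit along an edge of B. *)
pose d := (2 ^ (kC - kB))%N.
have wd : width B = d%:R * width C.
  rewrite wB wC /d natrX -{2}(subnK kBC) exprD.
  by field; rewrite !expf_neq0.
apply: refines_sub => i; have [_ lB] := hB i; have [_ lC] := hC i.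
rewrite lower_scale upper_scale.
have [le1|gt1] := leP (lower B i - (3 - 1) / 2 * width B) (lower C i); last first.
  case: nsep; exists i; left; rewrite lower_scale.
  move: gt1; rewrite upperE lB lC wd.
  have -> : lower B0 i + (zB i)%:R * (d%:R * width C) - (3 - 1) / 2 * (d%:R * width C)
    = lower B0 i + ((zB i * d)%:R - d%:R) * width C by rewrite natrM; field.
  rewrite ltrD2l ltr_pM2r // ltrBrDr -natrD ltr_nat => h.
  rewrite -addrA lerD2l -{2}[width C]mul1r -mulrDl ler_pM2r // lerBrDr.
  by rewrite natr1 -natrD ler_nat addSn.
split=> //.
have [//|gt1] := leP (upper C i) (upper B i + (3 - 1) / 2 * width B).
case: nsep; exists i; right; rewrite upper_scale.
move: gt1; rewrite !upperE lB lC wd.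
have -> : lower B0 i + (zB i)%:R * (d%:R * width C) + d%:R * width C +
    (3 - 1) / 2 * (d%:R * width C)
  = lower B0 i + (zB i * d + d + d)%:R * width C by rewrite !natrD natrM; field.
rewrite -[ltRHS]addrA ltrD2l -{3}[width C]mul1r -mulrDl ltr_pM2r //.
rewrite natr1 ltr_nat ltnS => h.
by rewrite lerD2l ler_pM2r // ler_nat.
Qed.

Lemma subdivideP B C : C \in subdivide B ->
  width C = width B / 2 /\
  forall i, exists b : bool, lower C i = lower B i + b%:R * width C.
Proof.
case/mapP => s _ ->; split=> // i; exists (i \notin s).
rewrite /lower /Defs.center /width /= !mxE.
by case: (i \in s); rewrite ?expr0 ?expr1 /=; field.
Qed.

Lemma subdivide_refines B C : 0 < width B -> C \in subdivide B ->
  width C <= width B /\ refines C B.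
Proof.
move=> Bpos /subdivideP[wC lC]; split; first by lra.
by move=> i; have [b lb] := lC i; rewrite !upperE lb; case: b {lb} => /=; split; lra.
Qed.

Lemma dyadic_subdivide B C : dyadic B0 B -> C \in subdivide B -> dyadic B0 C.
Proof.
move=> [k [z [wB zB]]] /subdivideP[wC /boolp.choice[b lC]].
exists k.+1, (fun i => (z i).*2 + b i)%N; split.
  by rewrite wC wB exprSr invfM mulrA.
move=> i; have [zk lB] := zB i; split.
  rewrite expnS mul2n; case: (b i); rewrite ?addn0 ?ltn_double // addn1.
  by rewrite ltn_Sdouble.
by rewrite lC lB wC natrD -mul2n natrM; field.
Qed.

Lemma subdivide_cover B x : points B x -> exists2 C, C \in subdivide B & points C x.
Proof.
(* Membership in s encodes the lower half, as its sign is -1. *)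
move=> Bx; pose s := finset (fun i => x 0 i <= Defs.center B 0 i).
exists (Defs.center B + \row_i ((-1) ^+ (i \in s) * (width B / 4)), width B / 2).
  by apply/mapP; exists s; rewrite ?mem_enum.
move=> i; have := Bx i; rewrite /lower /upper /Defs.center /width /= !mxE inE.
move=> /andP[a b]; have [xi|xi] := leP (x 0 i) (Defs.center B 0 i);
  rewrite ?expr0 ?expr1; rewrite /Defs.center in xi; apply/andP; split; lra.
Qed.
End Dyadic.
End Grid.

(** * The loop invariant *)

Section Loop.
Variables (R : realType) (n : nat) (f : 'rV[R]_n -> 'rV[R]_n) (B0 : box R n).
Hypothesis fC2 : twice_continuously_differentiable f.
Hypothesis B0pos : 0 < width B0.
Implicit Types (B C D : box R n) (P Q : seq (box R n)).

(** The clause of output_double about the queue is what keeps later outputs away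
from the earlier ones: it passes to subboxes of queued boxes, so it survives
subdivision. *)
Record loop_inv P Q : Prop := LoopInv {
  queue_dyadic : forall C, C \in Q -> dyadic B0 C;
  output_double : forall D, D \in P -> exists B,
    [/\ D = scale_box 2 B, dyadic B0 B, isolating f D &
        forall C, C \in Q ->
          width C <= width B /\ separated C (scale_box 3 B)];
  output_disjoint : nonoverlapping P;
  zeros_covered : forall x, points B0 x -> f x = 0 ->
    exists2 D, D \in P ++ Q & points D x
}.

Lemma loop_inv_init : loop_inv [::] [:: B0].
Proof.
split=> // [C|x Bx _]; first by rewrite inE => /eqP->; exact: dyadic_refl.
by exists B0; rewrite ?inE.
Qed.

(** Common form of the steps without output: B is replaced by smaller dyadic boxes
S that catch all of its zeros, namely by nothing or by its subdivision. *)
Lemma loop_inv_replace P Q B Q1 S : loop_inv P Q -> remove Q B Q1 ->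
  (forall C, C \in S -> [/\ dyadic B0 C, width C <= width B & refines C B]) ->
  (forall x, points B x -> f x = 0 -> exists2 C, C \in S & points C x) ->
  loop_inv P (Q1 ++ S).
Proof.
move=> [qd od odis zc] /perm_mem QB SB Scov.
have BQ : B \in Q by rewrite QB inE eqxx.
have Q1Q C : C \in Q1 -> C \in Q by rewrite QB inE orbC => ->.
split=> // [C|D DP|x Bx fx].
- by rewrite mem_cat => /orP[/Q1Q/qd //|/SB[]].
- have [B' [DE dB' iso sep]] := od D DP; exists B'; split=> // C.
  rewrite mem_cat => /orP[/Q1Q/sep //|/SB[_ CB refCB]].
  have [BB' sepB] := sep B BQ.
  by split; [exact: le_trans BB'|exact: separated_refines sepB].
- have [D + Dx] := zc x Bx fx.
  rewrite mem_cat QB inE => /or3P[DP|/eqP DB|DQ1].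
  + by exists D => //; rewrite mem_cat DP.
  + have [|C CS Cx] := Scov x _ fx; first by rewrite -DB.
    by exists C => //; rewrite !mem_cat CS !orbT.
  + by exists D => //; rewrite !mem_cat DQ1 orbT.
Qed.

Lemma loop_inv_excluded P Q B Q1 :
  loop_inv P Q -> remove Q B Q1 -> C0 f B -> loop_inv P Q1.
Proof.
move=> inv rm [i ni]; rewrite -[Q1]cats0; apply: loop_inv_replace inv rm _ _ => //.
by move=> x Bx fx; case: ni; exists x => //=; rewrite fx mxE.
Qed.

Lemma loop_inv_subdivide P Q B Q1 :
  loop_inv P Q -> remove Q B Q1 -> loop_inv P (Q1 ++ subdivide B).
Proof.
move=> inv rm; have dB : dyadic B0 B.
  by apply: (queue_dyadic inv); rewrite (perm_mem rm) inE eqxx.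
apply: loop_inv_replace inv rm _ _ => [C CB|x Bx _]; last exact: subdivide_cover.
have [wC rC] := subdivide_refines (dyadic_width_gt0 B0pos dB) CB.
by split=> //; exact: dyadic_subdivide CB.
Qed.

(** The new box is isolating by the analytic part. The boxes that remain in the
queue are at most as wide as B because B was a biggest one, and they are not
inside 3B, so they are separated from it; a covering box that is discarded has
its zeros in 3B, hence in 2B. *)
Lemma loop_inv_found P Q B Q1 m : loop_inv P Q -> remove_biggest Q B Q1 ->
  JC f B -> MK_point f B m -> MK f B m ->
  loop_inv (rcons P (scale_box 2 B)) (discard_inside (scale_box 3 B) Q1).
Proof.
move=> [qd od odis zc] [/perm_mem QB big] jc Bm mk.
have BQ : B \in Q by rewrite QB inE eqxx.
have Q1Q C : C \in Q1 -> C \in Q by rewrite QB inE orbC => ->.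
have dB := qd B BQ; have Bpos := dyadic_width_gt0 B0pos dB.
have [iso zeros3] := MK_isolating fC2 Bpos jc Bm mk.
have discQ C : C \in discard_inside (scale_box 3 B) Q1 ->
    C \in Q /\ ~ points C `<=` points (scale_box 3 B).
  by rewrite mem_filter => /andP[/asboolPn nC /Q1Q].
split.
- by move=> C /discQ[/qd].
- move=> D; rewrite mem_rcons inE => /predU1P[->|DP].
    exists B; split=> // C /discQ[CQ nC]; split; first exact: big.
    exact: (dyadic_dichotomy B0pos dB (qd C CQ) (big C CQ) nC).
  have [B' [DE dB' isoD sep]] := od D DP; exists B'; split=> // C /discQ[CQ _].
  exact: sep.
- rewrite /nonoverlapping pairwise_rcons; apply/andP; split; last exact: odis.
  apply/allP => D DP; apply/asboolP; have [B' [-> dB' _ sep]] := od D DP.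
  have [BB' sepB] := sep B BQ.
  by apply: separated_disjoint; exact: separated_double.
- move=> x Bx fx; have [D + Dx] := zc x Bx fx.
  have [D3 _|D3] := pselect (points (scale_box 3 B) x).
    exists (scale_box 2 B); last exact: zeros3.
    by rewrite mem_cat mem_rcons inE eqxx.
  rewrite mem_cat QB inE => /or3P[DP|/eqP DB|DQ1]; exists D => //.
  + by rewrite mem_cat mem_rcons inE DP orbT.
  + case: D3; rewrite DB in Dx.
    by apply: (@points_scale_mono _ _ _ 1) => //; [lra|rewrite scale_box1].
  + rewrite mem_cat mem_filter DQ1 andbT; apply/orP; right.
    by apply/asboolPn => sub; exact/D3/sub.
Qed.

Lemma remove_singleton B Q' B' : remove [:: B] B' Q' -> B' = B /\ Q' = [::].
Proof.
move=> rm; have := perm_size rm; case: Q' rm => // rm _; split=> //.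
by have := perm_mem rm B'; rewrite !inE eqxx => /eqP.
Qed.

Lemma inner_loop_nil B P Q P1 Q1 :
  inner_loop f B P Q [::] P1 Q1 -> P1 = P /\ Q1 = Q.
Proof.
move E : [::] => Q' H; case: H E => // [P' Q0 {}Q' B' Q'' m|P' Q0 {}Q' B' Q'' P2 Q2] rm.
  by move=> _ _ _ E; move: rm; rewrite -E => /perm_size.
by move=> _ _ E; move: rm; rewrite -E => /perm_size.
Qed.

(** Nothing is ever added to the inner queue, so the inner loop makes a single
iteration, on B itself. *)
Lemma inner_loop_start B P Q P1 Q1 : inner_loop f B P Q [:: B] P1 Q1 ->
  (exists m, [/\ MK_point f B m, MK f B m, P1 = rcons P (scale_box 2 B) &
                 Q1 = discard_inside (scale_box 3 B) Q]) \/
  (P1 = P /\ Q1 = Q ++ subdivide B).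
Proof.
move E : [:: B] => Q' H; case: H E => // [P' Q0 {}Q' B' Q'' m|P' Q0 {}Q' B' Q'' P2 Q2] rm.
  move=> _ pt mk E; move: rm; rewrite -E => /remove_singleton[EB _].
  by subst B'; left; exists m.
move=> _ H E; move: rm; rewrite -E => /remove_singleton[_ EQ].
by subst Q''; right; exact: inner_loop_nil H.
Qed.

Lemma outer_loop_inv P Q P1 : outer_loop f P Q P1 -> loop_inv P Q -> loop_inv P1 [::].
Proof.
elim=> {P Q P1} [//|P Q B Q1 P1 [rm _] excl _ IH inv|
  P Q B Q1 P2 Q2 P1 rm _ jc inner _ IH inv|P Q B Q1 P1 [rm _] _ _ _ IH inv].
- exact/IH/(loop_inv_excluded inv rm excl).
- apply: IH; case: (inner_loop_start inner) => [[m [pt mk -> ->]]|[-> ->]].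
    exact: loop_inv_found inv rm jc pt mk.
  exact: loop_inv_subdivide inv rm.1.
- exact/IH/(loop_inv_subdivide inv rm).
Qed.
End Loop.

Theorem theorem6p1 (R : realType) (n : nat)
    (f : 'rV[R]_n -> 'rV[R]_n) (mu : 'rV[R]_n -> nat)
    (B0 : box R n) (P : seq (box R n)) :
  twice_continuously_differentiable f ->
  is_multiplicity f mu ->
  0 < width B0 ->
  finite_set [set x | points (scale_box 2 B0) x /\ f x = 0] ->
  (forall x, points (scale_box 2 B0) x -> f x = 0 -> simple_zero f x) ->
  Miranda_halts f B0 P ->
  [/\ nonoverlapping P,
      (forall B : box R n, B \in P -> isolating f B),
      msubset (Zero f mu (points B0))
              (mbigcup P (fun B => Zero f mu (points B))) &
      msubset (mbigcup P (fun B => Zero f mu (points B)))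
              (Zero f mu (points (scale_box 2 B0)))].
Proof.
move=> fC2 _ B0pos _ _ halts.
have [_ od dis zc] := outer_loop_inv fC2 B0pos halts (loop_inv_init f B0).
split=> // [D /od[B []] //|x|x].
- rewrite {1}/Zero; case: asboolP => // -[Bx fx].
  have [D DP Dx] := zc x Bx fx; rewrite cats0 in DP.
  apply: leq_trans (leq_bigmax_seq _ DP isT); rewrite /Zero.
  by case: asboolP => // -[].
- rewrite /mbigcup; apply/bigmax_leqP_seq => D DP _; rewrite /Zero.
  case: asboolP => // -[Dx fx]; case: asboolP => // -[]; split=> //.
  have [B [DE dB _ _]] := od D DP.
  by apply: (dyadic_double_sub B0pos dB); rewrite -DE.
Qed.
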